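(* There exists a property (an isomorphism-closed class of finite structures over a vocabulary consisting of one binary relation symbol) that is definable by an order-invariant $\mathsf{CFO}$ sentence but is not definable by any first-order sentence.
   Context: Cluster first-order logic ($\mathsf{CFO}$) over a vocabulary with a binary relation symbol $E$ (and possibly unary symbols $P_\ell$) plus an order symbol $<$ interpreted as a linear order: fix an infinite alphabet $\Sigma$; variables $x_w^i$ ($w\in\Sigma^*$, $i\in\mathbb N$). For finite $S\subseteq\Sigma^*\times\mathbb N$, $X_S=\{x_w^i:(w,i)\in S\}$; $S$ is valid if $(w,i)\in S\Rightarrow(w,j)\in S$ for $j<i$ and $(w\alpha,0)\in S\Rightarrow(w,0)\in S$. $\mathsf{CFO}_S[0]$: Boolean combinations of $P_\ell(x_w^i)$, $E(x_w^i,x_w^j)$, $x_w^i\sim x_w^j$, $x_{w\alpha}^0\sim x_w^i$ (variables in $X_S$, $\sim\in\{=,<,>\}$). $\mathsf{CFO}_S[k+1]$: Boolean combinations of $\mathsf{CFO}_S[0]$ formulas and of $\exists x_\epsilon^0\psi$ ($S=\emptyset$, $\psi\in\mathsf{CFO}_{\{(\epsilon,0)\}}[k]$), $\exists x^0_{w\alpha}\psi$ ($(w,0)\in S$, $(w\alpha,0)\notin S$, $\psi\in\mathsf{CFO}_{S\cup\{(w\alpha,0)\}}[k]$), $\exists x_w^i(E(x_w^i,x_w^j)\wedge\psi)$ ($(w,j)\in S$, $i$ least with $(w,i)\notin S$, $\psi\in\mathsf{CFO}_{S\cup\{(w,i)\}}[k]$). $\mathsf{CFO}=\bigcup_k\mathsf{CFO}_\emptyset[k]$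 with usual first-order semantics. A $\mathsf{CFO}$ sentence is order-invariant if, on every finite structure, its truth value does not depend on which linear order interprets $<$. *)

(* Defs.v *)
From HB Require Import structures.
From mathcomp Require Import all_boot finmap.

Set Implicit Arguments.
Unset Strict Implicit.
Unset Printing Implicit Defensive.

(** First-order logic over a relational vocabulary with unary symbols [U],
    binary symbols [B], and variables from [V]. *)

Inductive formula (U B V : Type) : Type :=
| Fbot
| Feq of V & V
| Fun of U & V
| Fbin of B & V & V
| Fnot of formula U B V
| Fand of formula U B V & formula U B V
| For of formula U B V & formula U B V
| Fex of V & formula U B V.

Arguments Fbot {U B V}.
Arguments Feq {U B V}.
Arguments Fun {U B V}.
Arguments Fbin {U B V}.

(* Finite structures are nonempty, as is standard; [truth] relies on it. *)
Record structure (U B : Type) : Type := Structure {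
  dom :> finType;
  dom_gt0 : 0 < #|dom|;
  uni : U -> pred dom;
  bin : B -> rel dom
}.

Definition upd (V : eqType) (T : Type) (v : V -> T) (x : V) (a : T) : V -> T :=
  fun y => if y == x then a else v y.

Fixpoint sat (U B : Type) (V : eqType) (M : structure U B) (v : V -> M)
    (phi : formula U B V) : bool :=
  match phi with
  | Fbot => false
  | Feq x y => v x == v y
  | Fun l x => uni l (v x)
  | Fbin b x y => bin b (v x) (v y)
  | Fnot f => ~~ sat v f
  | Fand f g => sat v f && sat v g
  | For f g => sat v f || sat v g
  | Fex x f => [exists a : M, sat (upd v x a) f]
  end.

Fixpoint free_vars (U B : Type) (V : eqType) (phi : formula U B V) : seq V :=
  match phi with
  | Fbot => [::]
  | Feq x y => [:: x; y]
  | Fun _ x => [:: x]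
  | Fbin _ x y => [:: x; y]
  | Fnot f => free_vars f
  | Fand f g => free_vars f ++ free_vars g
  | For f g => free_vars f ++ free_vars g
  | Fex x f => [seq y <- free_vars f | y != x]
  end.

Definition sentence (U B : Type) (V : eqType) (phi : formula U B V) : Prop :=
  free_vars phi = [::].

(* Meant for sentences, whose value does not depend on the valuation. *)
Definition truth (U B : Type) (V : eqType) (M : structure U B)
    (phi : formula U B V) : Prop :=
  forall v : V -> M, sat v phi.

Definition isomorphic (U B : Type) (M N : structure U B) : Prop :=
  exists f : M -> N,
    [/\ bijective f,
        forall (l : U) (x : M), uni l (f x) = uni l x &
        forall (b : B) (x y : M), bin b (f x) (f y) = bin b x y].

Definition iso_closed (U B : Type) (P : structure U B -> Prop) : Prop :=
  forall M N : structure U B, isomorphic M N -> P M -> P N.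

Definition FO_definable (U B : Type) (P : structure U B -> Prop) : Prop :=
  exists phi : formula U B nat,
    sentence phi /\ forall M : structure U B, P M <-> truth M phi.

(** Ordered expansions. *)

Variant ordered (B : Type) : Type := Base of B | Less.
Arguments Less {B}.

Definition linear_order (T : eqType) (lt : rel T) : Prop :=
  [/\ irreflexive lt, transitive lt &
      forall x y : T, x != y -> lt x y || lt y x].

Definition expand (U B : Type) (M : structure U B) (lt : rel M) :
    structure U (ordered B) :=
  @Structure U (ordered B) (dom M) (dom_gt0 M) (@uni U B M)
    (fun s => match s with Base b => bin b | Less => lt end).

Definition order_invariant (U B : Type) (V : eqType)
    (phi : formula U (ordered B) V) : Prop :=
  forall (M : structure U B) (lt1 lt2 : rel M),
    linear_order lt1 -> linear_order lt2 ->
    truth (expand lt1) phi <-> truth (expand lt2) phi.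

(** Cluster first-order logic. *)

Variant edge_symbol : Set := E.

(* [(w, i)] stands for the variable x_w^i; [rcons w a] is the word w a. *)
Definition cvar (Sigma : choiceType) : choiceType := (seq Sigma * nat)%type.

Definition cformula (U : Type) (Sigma : choiceType) : Type :=
  formula U (ordered edge_symbol) (cvar Sigma).

Definition infinite_alphabet (Sigma : choiceType) : Prop :=
  forall s : seq Sigma, exists a : Sigma, a \notin s.

Definition valid (Sigma : choiceType) (S : {fset cvar Sigma}) : Prop :=
  (forall (w : seq Sigma) (i j : nat), j < i -> (w, i) \in S -> (w, j) \in S)
  /\ (forall (w : seq Sigma) (a : Sigma),
        (rcons w a, 0) \in S -> (w, 0) \in S).

Inductive boolean_combination (U B V : Type) (A : formula U B V -> Prop) :
    formula U B V -> Prop :=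
| bc_base f : A f -> boolean_combination A f
| bc_bot : boolean_combination A Fbot
| bc_not f : boolean_combination A f -> boolean_combination A (Fnot f)
| bc_and f g : boolean_combination A f -> boolean_combination A g ->
    boolean_combination A (Fand f g)
| bc_or f g : boolean_combination A f -> boolean_combination A g ->
    boolean_combination A (For f g).

(* [comparison x y f]: [f] is one of x = y, x < y, x > y. *)
Variant comparison (U B V : Type) (x y : V) : formula U (ordered B) V -> Prop :=
| cmp_eq : comparison x y (Feq x y)
| cmp_lt : comparison x y (Fbin Less x y)
| cmp_gt : comparison x y (Fbin Less y x).

Variant cfo_atom (U : Type) (Sigma : choiceType) (S : {fset cvar Sigma}) :
    cformula U Sigma -> Prop :=
| atom_unary l w i : (w, i) \in S -> cfo_atom S (Fun l (w, i))
| atom_edge w i j : (w, i) \in S -> (w, j) \in S ->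
    cfo_atom S (Fbin (Base E) (w, i) (w, j))
| atom_cluster w i j f : (w, i) \in S -> (w, j) \in S ->
    comparison (w, i) (w, j) f -> cfo_atom S f
| atom_parent w a i f : (rcons w a, 0) \in S -> (w, i) \in S ->
    comparison (rcons w a, 0) (w, i) f -> cfo_atom S f.

(* One quantifier in front of a formula [psi] of the class [C S'], where [S']
   is [S] extended with the quantified variable. *)
Variant cfo_quantified (U : Type) (Sigma : choiceType)
    (C : {fset cvar Sigma} -> cformula U Sigma -> Prop)
    (S : {fset cvar Sigma}) : cformula U Sigma -> Prop :=
| quant_root psi :
    S = fset0 ->
    C [fset ([::], 0)]%fset psi ->
    cfo_quantified C S (Fex ([::], 0) psi)
| quant_child w a psi :
    (w, 0) \in S -> (rcons w a, 0) \notin S ->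
    C ((rcons w a, 0) |` S)%fset psi ->
    cfo_quantified C S (Fex (rcons w a, 0) psi)
| quant_cluster w i j psi :
    (w, j) \in S ->
    (w, i) \notin S -> (forall i', i' < i -> (w, i') \in S) ->
    C ((w, i) |` S)%fset psi ->
    cfo_quantified C S (Fex (w, i) (Fand (Fbin (Base E) (w, i) (w, j)) psi)).

Definition cfo0 (U : Type) (Sigma : choiceType) (S : {fset cvar Sigma}) :
    cformula U Sigma -> Prop :=
  boolean_combination (@cfo_atom U Sigma S).

Fixpoint cfo (U : Type) (Sigma : choiceType) (k : nat)
    (S : {fset cvar Sigma}) (phi : cformula U Sigma) : Prop :=
  valid S /\
  match k with
  | 0 => cfo0 S phi
  | k'.+1 =>
      boolean_combination
        (fun f => cfo0 S f \/ cfo_quantified (@cfo U Sigma k') S f) phi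
  end.

Definition CFO (U : Type) (Sigma : choiceType) (phi : cformula U Sigma) : Prop :=
  exists k : nat, cfo k fset0 phi.

Definition order_invariant_CFO_definable (U : Type) (Sigma : choiceType)
    (P : structure U edge_symbol -> Prop) : Prop :=
  exists phi : cformula U Sigma,
    [/\ CFO phi, order_invariant phi &
        forall (M : structure U edge_symbol) (lt : rel M),
          linear_order lt -> P M <-> truth (expand lt) phi].

(* Main.v *)
Require Import Defs.
From mathcomp Require Import all_boot finmap.
From mathcomp Require Import zify.

Set Implicit Arguments.
Unset Strict Implicit.
Unset Printing Implicit Defensive.

(** The separating property is Gurevich's: parity of the number of atoms of a
    power set algebra, with the edge relation read as inclusion. A subset of
    the atoms is coded by an element, so with an order one can ask for an
    element containing exactly the atoms of even rank, and the answer depends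
    on the number of atoms only. The locality of CFO is no obstacle, because
    the top element is a hub: every element has an edge to it, so that all
    variables can live in its cluster. That an element is a hub is itself
    expressed by comparing the root of a child cluster with the neighbours of
    the element. Without an order, an Ehrenfeucht-Fraisse game does not
    distinguish the power sets of two sets with at least [2 ^ k] elements in [k]
    rounds. *)

(** * Power set structures and the Ehrenfeucht-Fraisse game on them *)

Lemma card_set_gt0 (T : finType) : 0 < #|{: {set T}}|.
Proof. by apply/card_gt0P; exists set0. Qed.

Definition powerset_structure (T : finType) : structure void edge_symbol :=
  @Structure void edge_symbol {set T} (card_set_gt0 T)
    (fun l _ => match l with end) (fun _ A B => A \subset B).

Fixpoint qrank (U B V : Type) (phi : formula U B V) : nat :=
  match phi with
  | Fbot | Feq _ _ | Fun _ _ | Fbin _ _ _ => 0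
  | Fnot f => qrank f
  | Fand f g | For f g => maxn (qrank f) (qrank g)
  | Fex _ f => (qrank f).+1
  end.

Definition pattern (T : finType) (L : seq {set T}) (i : T) : seq bool :=
  [seq i \in A | A : {set T} <- L].

(** The nonempty cells are the atoms of the Boolean algebra generated by [L]; a [t] whose length
    differs from that of [L] gives the empty cell. *)
Definition cell (T : finType) (L : seq {set T}) (t : seq bool) : {set T} :=
  [set i | pattern L i == t].

(* The Ehrenfeucht-Fraisse invariant with [r] rounds left: each cell of the
   partition generated by [L] has the same size in [L'], up to threshold
   [2 ^ r]. *)
Definition similar (r : nat) (T T' : finType)
    (L : seq {set T}) (L' : seq {set T'}) : Prop :=
  forall t, minn #|cell L t| (2 ^ r) = minn #|cell L' t| (2 ^ r).

Lemma similar_sym r (T T' : finType) (L : seq {set T}) (L' : seq {set T'}) :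
  similar r L L' -> similar r L' L.
Proof. by move=> h t; rewrite h. Qed.

Lemma cell_cons (T : finType) (L : seq {set T}) (A : {set T}) b t :
  cell (A :: L) (b :: t) = if b then cell L t :&: A else cell L t :\: A.
Proof.
apply/setP=> i; rewrite !inE /= eqseq_cons.
by case: b; rewrite !inE; case: (i \in A); case: (_ == t).
Qed.

Lemma cell_nil (T : finType) (L : seq {set T}) (A : {set T}) :
  cell (A :: L) [::] = set0.
Proof. by apply/setP=> i; rewrite !inE. Qed.

(** This halving is why the thresholds are powers of 2. If both parts reach [K], cut [c] at [K];
    otherwise copy exactly a part smaller than [K] and leave the rest to the other. *)
Lemma threshold_split K p q c :
  minn (p + q) (2 * K) = minn c (2 * K) ->
  exists p', [/\ p' <= c, minn p K = minn p' K & minn q K = minn (c - p') K].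
Proof.
move=> h; case: (leqP (2 * K) (p + q)) => hpq; last by exists p; split; lia.
case: (ltnP p K) => hp; first by exists p; split; lia.
case: (ltnP q K) => hq; first by exists (c - q); split; lia.
by exists K; split; lia.
Qed.

(** The answer [B] to the move [A] is built cell by cell, since [A] cuts the cells of [L]
    independently of each other. *)
Lemma similar_extend r (T T' : finType) (L : seq {set T}) (L' : seq {set T'}) :
  similar r.+1 L L' -> forall A, exists B, similar r (A :: L) (B :: L').
Proof.
move=> simL A.
(* The boolean form lets [xchoose] pick one size for each [t]. *)
have split t : exists p', [&& p' <= #|cell L' t|,
    minn #|cell L t :&: A| (2 ^ r) == minn p' (2 ^ r) &
    minn #|cell L t :\: A| (2 ^ r) == minn (#|cell L' t| - p') (2 ^ r)].
  have := simL t; rewrite -(cardsID A) expnS => /threshold_split[p' [h1 h2 h3]].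
  by exists p'; rewrite h1 h2 h3 !eqxx.
(* An initial segment of the enumeration of a cell is a subset of the chosen size; [B] collects
   these subsets over all cells. *)
pose D t : {set T'} := [set j in take (xchoose (split t)) (enum (cell L' t))].
pose B := [set j | j \in D (pattern L' j)].
have subD t : D t \subset cell L' t.
  by apply/subsetP=> j; rewrite inE => /mem_take; rewrite mem_enum.
have cellB t : cell L' t :&: B = D t.
  apply/setP=> j; rewrite in_setI [j \in B]in_set; apply/andP/idP => [[]|jD].
    by rewrite in_set => /eqP ->.
  have jt := subsetP (subD t) _ jD; split=> //.
  by move: jt; rewrite in_set => /eqP ->.
exists B => -[|b t]; first by rewrite !cell_nil !cards0.
have /and3P[h1 /eqP h2 /eqP h3] := xchooseP (split t).
have cardD : #|D t| = xchoose (split t).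
  rewrite cardsE (card_uniqP _) ?take_uniq ?enum_uniq //.
  by rewrite size_take -cardE; case: ltngtP h1.
have cardDC : #|cell L' t :\: B| = #|cell L' t| - #|D t|.
  by rewrite -(cardsID B (cell L' t)) cellB addKn.
by rewrite !cell_cons; case: b; rewrite ?cellB ?cardDC cardD.
Qed.

(** The threshold [2 ^ r] is at least 1, so it separates empty cells from nonempty ones. *)
Lemma similar_pattern r (T T' : finType) (L : seq {set T}) (L' : seq {set T'}) i :
  similar r L L' -> exists j, pattern L' j = pattern L i.
Proof.
move=> sim; have : 0 < #|cell L' (pattern L i)|.
  have : 0 < #|cell L (pattern L i)| by apply/card_gt0P; exists i; rewrite inE.
  by have := sim (pattern L i); have := expn_gt0 2 r; lia.
by case/card_gt0P=> j; rewrite inE => /eqP ji; exists j.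
Qed.

(** Whether an inclusion fails at a point depends only on the pattern of the point, and both sides
    realise the same patterns. *)
Lemma similar_subset r (T T' : finType) (h : seq ({set T} * {set T'})) A B A' B' :
  similar r (unzip1 h) (unzip2 h) -> (A, A') \in h -> (B, B') \in h ->
  (A \subset B) = (A' \subset B').
Proof.
move=> sim hA hB; apply/idP/idP=> /subsetP sAB; apply/subsetP=> j.
  have [i] := similar_pattern j (similar_sym sim).
  rewrite /pattern -!map_comp => /eq_in_map ij.
  by have /= <- := ij _ hA; have /= <- := ij _ hB; apply: sAB.
have [i] := similar_pattern j sim; rewrite /pattern -!map_comp => /eq_in_map ij.
by have /= <- := ij _ hA; have /= <- := ij _ hB; apply: sAB.
Qed.

(** The list [h] holds the pairs played so far. It has to contain the current values of the free
    variables only, so the old pair of a requantified variable may stay in it. *)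
Lemma similar_sat (T T' : finType) (phi : formula void edge_symbol nat) :
  forall (r : nat) (h : seq ({set T} * {set T'}))
    (v : nat -> powerset_structure T) (w : nat -> powerset_structure T'),
  qrank phi <= r -> similar r (unzip1 h) (unzip2 h) ->
  (forall x, x \in free_vars phi -> ((v x, w x) : {set T} * {set T'}) \in h) ->
  sat v phi = sat w phi.
Proof.
elim: phi => [|x y|[]|[] x y|f IH|f IHf g IHg|f IHf g IHg|x f IH] r h v w //=.
- move=> _ sim hv; have hx := hv x (mem_head _ _).
  have hy : ((v y, w y) : {set T} * {set T'}) \in h by apply: hv; rewrite !inE eqxx orbT.
  rewrite -[LHS]/((v x : {set T}) == v y) -[RHS]/((w x : {set T'}) == w y).
  by rewrite !eqEsubset (similar_subset sim hx hy) (similar_subset sim hy hx).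
- move=> _ sim hv; by apply: (similar_subset sim); apply: hv; rewrite !inE ?eqxx ?orbT.
- by move=> hr sim hv; rewrite (IH r h v w).
- rewrite geq_max => /andP[hf hg] sim hv.
  by rewrite (IHf r h v w) ?(IHg r h v w) // => x hx; apply: hv; rewrite mem_cat hx ?orbT.
- rewrite geq_max => /andP[hf hg] sim hv.
  by rewrite (IHf r h v w) ?(IHg r h v w) // => x hx; apply: hv; rewrite mem_cat hx ?orbT.
- case: r => // r hr sim hv.
  have IHx A B : similar r (A :: unzip1 h) (B :: unzip2 h) ->
      sat (upd v x A) f = sat (upd w x B) f.
    move=> simAB; apply: (IH r ((A, B) :: h)) => // y yf.
    rewrite /upd; case: eqVneq => yx; first exact: mem_head.
    by rewrite in_cons hv ?orbT // mem_filter yx.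
  apply/existsP/existsP=> -[A hA].
    by have [B /IHx AB] := similar_extend sim A; exists B; rewrite -AB.
  have [B /similar_sym/IHx AB] := similar_extend (similar_sym sim) A.
  by exists B; rewrite AB.
Qed.

(** * The separating property and its value on power sets *)

Definition below (M : structure void edge_symbol) (x : M) : {set M} :=
  [set z | bin E z x].

(** Makes sense in any structure; in a power set these are the singletons, which have only the empty
    set and themselves below. *)
Definition atoms (M : structure void edge_symbol) : {set M} :=
  [set a | bin E a a & #|below a| == 2].

Definition trace (M : structure void edge_symbol) (X : M) : {set M} :=
  below X :&: atoms M.

(** Comprehension: a quantifier over elements acts as one over sets of atoms. *)
Definition full_atoms (M : structure void edge_symbol) : Prop :=
  forall S : {set M}, S \subset atoms M -> exists X, trace X = S.

Definition even_powerset (M : structure void edge_symbol) : Prop :=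
  [/\ exists H : M, below H = setT, full_atoms M & ~~ odd #|atoms M|].

Lemma imset_bij_set (T T' : finType) (f : T -> T') (P : pred T) (P' : pred T') :
  bijective f -> (forall x, P' (f x) = P x) ->
  [set y | P' y] = f @: [set x | P x].
Proof.
move=> [g fK gK] PP'; apply/setP=> y.
by rewrite -[y]gK (mem_imset _ _ (can_inj fK)) !inE PP'.
Qed.

Lemma even_powerset_iso : iso_closed even_powerset.
Proof.
move=> M N [f [bf _ fE]] [[H topH] fullM evenM].
have f_inj := bij_inj bf.
have belowE x : below (f x) = f @: below x by apply: imset_bij_set.
have atomsE : atoms N = f @: atoms M.
  by apply: imset_bij_set => // x; rewrite fE belowE card_imset.
have traceE X : trace (f X) = f @: trace X.
  by rewrite /trace imsetI ?belowE ?atomsE // => x y _ _; apply: f_inj.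
split; last by rewrite atomsE card_imset.
  exists (f H); rewrite belowE topH; have [g fK gK] := bf.
  by apply/setP=> y; rewrite -[y]gK (mem_imset _ _ f_inj) !inE.
move=> S; rewrite atomsE => SN.
have [|X XS] := fullM (f @^-1: S).
  apply/subsetP=> x; rewrite inE => /(subsetP SN).
  by rewrite (mem_imset _ _ f_inj).
exists (f X); rewrite traceE XS; apply/setP=> y; have [g fK gK] := bf.
by rewrite -[y]gK (mem_imset _ _ f_inj) inE.
Qed.

Lemma even_powerset_card (T : finType) :
  even_powerset (powerset_structure T) <-> ~~ odd #|T|.
Proof.
have belowE (A : powerset_structure T) : below A = powerset (A : {set T}).
  by apply/setP=> B; rewrite !inE.
have atomsE : atoms (powerset_structure T) = [set A : {set T} | #|A| == 1].
  apply/setP=> A; rewrite in_set [RHS]in_set /= subxx /= belowE card_powerset.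
  (* Here 2 is read as [2 ^ 1]. *)
  by rewrite (eqn_exp2l _ 1).
have card_atoms : #|atoms (powerset_structure T)| = #|T|.
  by rewrite atomsE (card_draws T 1) bin1.
split=> [[_ _]|evenT]; first by rewrite card_atoms.
split; last by rewrite card_atoms.
  by exists [set: T]; apply/setP=> A; rewrite !inE /= subsetT.
(* The witness is the union of the singletons in [S]. *)
move=> S /subsetP SA; exists [set i | [set i] \in (S : {set {set T}})].
apply/setP=> A; rewrite in_setI belowE atomsE [A \in powerset _]inE.
rewrite [A \in [set _ | _]]inE.
apply/andP/idP=> [[sAS /cards1P[i Ai]]|AS].
  by have := subsetP sAS i; rewrite Ai !inE eqxx; apply.
have := SA _ AS; rewrite atomsE inE => A1; split=> //.
by have /cards1P[i Ai] := A1; rewrite Ai sub1set inE -Ai.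
Qed.

Lemma even_powerset_not_FO : ~ FO_definable even_powerset.
Proof.
(* Both [n] and [n.+1] reach the threshold, and exactly one of them is even. *)
case=> phi [sphi hphi]; pose n := 2 ^ qrank phi.
have sim : similar (qrank phi) ([::] : seq {set 'I_n}) ([::] : seq {set 'I_n.+1}).
  have cell_nil m t : #|cell ([::] : seq {set 'I_m}) t| = if t is [::] then m else 0.
    case: t => [|b t]; last by apply: eq_card0 => i; rewrite inE.
    by rewrite -[RHS]card_ord; apply: eq_card => i; rewrite !inE.
  by move=> t; rewrite !cell_nil /n; case: t; lia.
have satE (v : nat -> powerset_structure 'I_n) (w : nat -> powerset_structure 'I_n.+1) :
    sat v phi = sat w phi.
  by apply: (similar_sat (h := [::]) (leqnn _) sim) => x; rewrite sphi.
have eqt : truth (powerset_structure 'I_n) phi <-> truth (powerset_structure 'I_n.+1) phi.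
  split=> tr v; first by rewrite -(satE (fun=> set0)).
  by rewrite (satE _ (fun=> set0)).
have := even_powerset_card 'I_n; have := even_powerset_card 'I_n.+1.
by rewrite !hphi eqt !card_ord /=; case: (odd n) => -[? ?] [? ?]; intuition.
Qed.

(** * Ordered first-order formulas inside the root cluster *)

Definition oformula : Type := formula void (ordered edge_symbol) nat.

(* Everything stays in the root cluster: the variable [x] becomes x_epsilon^x,
   and the edge guard to x_epsilon^0 is vacuous when that element is a hub. *)
Fixpoint to_cfo (Sigma : choiceType) (phi : oformula) : cformula void Sigma :=
  match phi with
  | Fbot => Fbot
  | Feq x y => Feq ([::], x) ([::], y)
  | Fun l x => Fun l ([::], x)
  | Fbin b x y => Fbin b ([::], x) ([::], y)
  | Fnot f => Fnot (to_cfo Sigma f)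
  | Fand f g => Fand (to_cfo Sigma f) (to_cfo Sigma g)
  | For f g => For (to_cfo Sigma f) (to_cfo Sigma g)
  | Fex x f =>
      Fex ([::], x) (Fand (Fbin (Base E) ([::], x) ([::], 0)) (to_cfo Sigma f))
  end.

(* A quantifier must bind the least index not yet in scope, as CFO requires
   inside a cluster. *)
Fixpoint levelled (n : nat) (phi : oformula) : bool :=
  match phi with
  | Fbot => true
  | Feq x y | Fbin _ x y => (x < n) && (y < n)
  | Fun _ x => x < n
  | Fnot f => levelled n f
  | Fand f g | For f g => levelled n f && levelled n g
  | Fex x f => (x == n) && levelled n.+1 f
  end.

(** Each step of the recursion is convertible to the extension of the scope in [quant_cluster]. *)
Fixpoint root_vars (Sigma : choiceType) (n : nat) : {fset cvar Sigma} :=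
  if n is m.+1 then (([::] : seq Sigma, m) |` root_vars Sigma m)%fset else fset0.

Lemma in_root_vars (Sigma : choiceType) n (w : seq Sigma) i :
  ((w, i) \in root_vars Sigma n) = (w == [::]) && (i < n).
Proof.
elim: n => [|n IH] /=; first by rewrite inE andbF.
rewrite in_fset1U IH xpair_eqE -andb_orr; congr andb; lia.
Qed.

Lemma valid_root_vars (Sigma : choiceType) n : valid (root_vars Sigma n).
Proof.
split=> [w i j ji|w a]; rewrite !in_root_vars; last by case: w.
by case/andP=> -> /(ltn_trans ji) ->.
Qed.

Section CfoClosure.

Variables (Sigma : choiceType) (k : nat) (S : {fset cvar Sigma}).
Implicit Types f g : cformula void Sigma.

Lemma cfo_base f : valid S -> cfo0 S f -> cfo k S f.
Proof. by case: k => [|k'] vS Sf; split=> //; apply: bc_base; left. Qed.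

Lemma cfo_atom_cfo f : valid S -> cfo_atom S f -> cfo k S f.
Proof. by move=> vS Sf; apply: cfo_base => //; apply: bc_base. Qed.

Lemma cfo_not f : cfo k S f -> cfo k S (Fnot f).
Proof. by case: k => [|k'] [vS bf]; split=> //; apply: bc_not. Qed.

Lemma cfo_and f g : cfo k S f -> cfo k S g -> cfo k S (Fand f g).
Proof. by case: k => [|k'] [vS bf] [_ bg]; split=> //; apply: bc_and. Qed.

Lemma cfo_or f g : cfo k S f -> cfo k S g -> cfo k S (For f g).
Proof. by case: k => [|k'] [vS bf] [_ bg]; split=> //; apply: bc_or. Qed.

Lemma cfo_quant f : valid S -> cfo_quantified (@cfo void Sigma k) S f -> cfo k.+1 S f.
Proof. by move=> vS Sf; split=> //; apply: bc_base; right. Qed.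

End CfoClosure.

(** The condition [0 < n] keeps the target of the edge guards in scope. *)
Lemma cfo_to_cfo (Sigma : choiceType) (phi : oformula) n k :
  0 < n -> levelled n phi -> qrank phi <= k ->
  cfo k (root_vars Sigma n) (to_cfo Sigma phi).
Proof.
have vn := valid_root_vars Sigma.
elim: phi n k => [|x y|[]|b x y|f IH|f IHf g IHg|f IHf g IHg|x f IH] n k n0 /=.
- by move=> _ _; apply: cfo_base => //; apply: bc_bot.
- case/andP=> xn yn _; apply: cfo_atom_cfo => //.
  by apply: (@atom_cluster _ _ _ [::] x y); rewrite ?in_root_vars //; apply: cmp_eq.
- case/andP=> xn yn _; apply: cfo_atom_cfo => //; case: b => [[]|].
    by apply: atom_edge; rewrite in_root_vars.
  by apply: (@atom_cluster _ _ _ [::] x y); rewrite ?in_root_vars //; apply: cmp_lt.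
- by move=> lf kf; apply/cfo_not/IH.
- rewrite geq_max => /andP[lf lg] /andP[kf kg].
  by apply: cfo_and; [apply: IHf|apply: IHg].
- rewrite geq_max => /andP[lf lg] /andP[kf kg].
  by apply: cfo_or; [apply: IHf|apply: IHg].
case: k => // k /andP[/eqP -> lf] kf; apply: cfo_quant => //.
apply: quant_cluster; rewrite ?in_root_vars ?ltnn ?n0 //.
  by move=> i ni; rewrite in_root_vars.
exact: (IH n.+1).
Qed.

Lemma sat_to_cfo (Sigma : choiceType) (M : structure void (ordered edge_symbol))
    (phi : oformula) n (v : cvar Sigma -> M) (w : nat -> M) :
  0 < n -> levelled n phi -> (forall x, bin (Base E) x (v ([::], 0))) ->
  (forall i, v ([::], i) = w i) -> sat v (to_cfo Sigma phi) = sat w phi.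
Proof.
elim: phi n v w => [|x y|[]|b x y|f IH|f IHf g IHg|f IHf g IHg|x f IH] n v w n0 /=.
- by [].
- by move=> _ _ vw; rewrite -!vw.
- by move=> _ _ vw; rewrite -!vw.
- by move=> lf hub vw; rewrite (IH n v w).
- by case/andP=> lf lg hub vw; rewrite (IHf n v w) ?(IHg n v w).
- by case/andP=> lf lg hub vw; rewrite (IHf n v w) ?(IHg n v w).
case/andP=> /eqP -> lf hub vw.
have updE a i : upd v ([::], n) a ([::], i) = upd w n a i.
  by rewrite /upd xpair_eqE eqxx vw.
(* As [n] is positive, no quantifier rebinds index 0: the hub stays fixed. *)
have upd0 a : upd v ([::], n) a ([::], 0) = v ([::], 0).
  by rewrite updE vw /upd; case: n n0 {lf updE}.
apply: eq_existsb => a; rewrite upd0 hub /=.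
by apply: (IH n.+1) => // z; rewrite upd0.
Qed.

(** * Derived connectives and the formula for atoms *)

Definition Fall {U B V} (x : V) (f : formula U B V) := Fnot (Fex x (Fnot f)).
Definition Fimp {U B V} (f g : formula U B V) := For (Fnot f) g.
Definition Fiff {U B V} (f g : formula U B V) := Fand (Fimp f g) (Fimp g f).

Section SatConnectives.

Variables (U B : Type) (V : eqType) (M : structure U B) (v : V -> M).
Implicit Types f g : formula U B V.

Lemma sat_all x f : sat v (Fall x f) = [forall a, sat (upd v x a) f].
Proof. by rewrite /= negb_exists; apply: eq_forallb => a /=; rewrite negbK. Qed.

Lemma sat_imp f g : sat v (Fimp f g) = (sat v f ==> sat v g).
Proof. by rewrite /= implybE. Qed.

Lemma sat_iff f g : sat v (Fiff f g) = (sat v f == sat v g).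
Proof. by rewrite /=; case: (sat v f); case: (sat v g). Qed.

Lemma sat_ex x f : sat v (Fex x f) = [exists a, sat (upd v x a) f].
Proof. by []. Qed.

Lemma sat_not f : sat v (Fnot f) = ~~ sat v f.
Proof. by []. Qed.

Lemma sat_and f g : sat v (Fand f g) = sat v f && sat v g.
Proof. by []. Qed.

Lemma upd_eq x (a : M) : upd v x a x = a.
Proof. by rewrite /upd eqxx. Qed.

Lemma upd_neq x y (a : M) : y != x -> upd v x a y = v y.
Proof. by rewrite /upd => /negbTE ->. Qed.

End SatConnectives.

(** Binds [n] and [n.+1], so for [x < n] it is levelled at [n]; variable [n] is the other element of
    [below x]. *)
Definition Fatom (n x : nat) : oformula :=
  Fex n (Fand (Fnot (Feq n x))
    (Fall n.+1 (Fiff (Fbin (Base E) n.+1 x) (For (Feq n.+1 x) (Feq n.+1 n))))).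

Lemma sat_atom (M : structure void edge_symbol) (lt : rel M) (v : nat -> expand lt) n x :
  x < n -> sat v (Fatom n x) = (v x \in atoms M).
Proof.
move=> xn.
have satE y : sat (upd v n y) (Fand (Fnot (Feq n x))
    (Fall n.+1 (Fiff (Fbin (Base E) n.+1 x) (For (Feq n.+1 x) (Feq n.+1 n)))))
  = (y != v x) && (below (v x) == [set v x; y]).
  have nx : x != n by lia.
  have nx1 : x != n.+1 by lia.
  have nn1 : n != n.+1 by lia.
  rewrite sat_and sat_not sat_all -[sat _ (Feq n x)]/(_ == _).
  rewrite !(upd_eq, upd_neq) //; congr andb.
  apply/forallP/eqP=> [h|h z].
    apply/setP=> z; have := h z; rewrite sat_iff /= !(upd_eq, upd_neq) // => /eqP.
    by rewrite !inE.
  rewrite sat_iff /= !(upd_eq, upd_neq) //; apply/eqP.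
  by have /setP/(_ z) := h; rewrite !inE.
rewrite /Fatom sat_ex in_set.
under eq_existsb => y do rewrite satE.
apply/existsP/andP=> [[y /andP[yx /eqP bvx]]|[Exx]].
  have : v x \in below (v x) by rewrite bvx !inE eqxx.
  by rewrite inE => ->; rewrite bvx cards2 (eq_sym (v x)) yx.
(* One of the two elements is [v x] by reflexivity; the other is the witness. *)
case/cards2P=> y [z [yz bx]]; have : v x \in below (v x) by rewrite inE.
rewrite bx !inE; case/orP=> /eqP vx; [exists z|exists y]; rewrite vx.
  by rewrite eq_sym yz eqxx.
by rewrite yz setUC eqxx.
Qed.

(** * Parity of a linearly ordered finite set *)

Definition alternating (T : finType) (lt : rel T) (A S : {set T}) : bool :=
  [forall a, (a \in A) ==>
    (((a \in S) == ~~ [exists b, [&& b \in A, b \in S, lt b a &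
       [forall c, (c \in A) ==> ~~ (lt b c && lt c a)]]]) &&
     ([forall b, (b \in A) ==> ~~ lt a b] ==> (a \notin S)))].

Section Alternating.

Variables (T : finType) (lt : rel T) (A : {set T}).
Hypothesis lt_linear : linear_order lt.

Let irr : irreflexive lt. Proof. by case: lt_linear. Qed.
Let trans : transitive lt. Proof. by case: lt_linear. Qed.
Let total x y : x != y -> lt x y || lt y x. Proof. by case: lt_linear => _ _; apply. Qed.

(** Its cardinality is the rank of [a] in [A], counted from 0. *)
Definition lower (a : T) : {set T} := [set b in A | lt b a].

Lemma card_lower_lt b a : b \in A -> lt b a -> #|lower b| < #|lower a|.
Proof.
move=> bA ba; apply: proper_card; apply/properP; split.
  by apply/subsetP=> c; rewrite !inE => /andP[-> /trans]; apply.
by exists b; rewrite !inE ?irr ?bA.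
Qed.

Lemma card_lower_pred b a : b \in A -> lt b a ->
  [forall c, (c \in A) ==> ~~ (lt b c && lt c a)] -> #|lower a| = #|lower b|.+1.
Proof.
move=> bA ba /forallP nb; have -> : lower a = b |: lower b.
  apply/setP=> c; rewrite !inE; case: eqVneq => [->|cb] /=; first by rewrite bA.
  case cA: (c \in A) => //=; apply/idP/idP=> [ca|/trans]; last exact.
  by have := nb c; rewrite cA ca andbT /=; have /orP[->|->] := total cb.
by rewrite cardsU1 !inE irr andbF.
Qed.

(** Take [b] of maximal rank below [a]: an element in between would have a larger rank. *)
Lemma exists_pred a : 0 < #|lower a| ->
  exists b, [/\ b \in A, lt b a & [forall c, (c \in A) ==> ~~ (lt b c && lt c a)]].
Proof.
case/card_gt0P=> b0 b0a; case: (arg_maxnP (fun b => #|lower b|) b0a) => b bla bmax.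
have : b \in lower a by []; rewrite inE => /andP[bA ba]; exists b; split=> //.
apply/forallP=> c; apply/implyP=> cA; apply/andP=> -[bc ca].
have cla : c \in lower a by rewrite inE cA.
by have := bmax c cla; rewrite /= leqNgt card_lower_lt.
Qed.

Lemma card_lower_last a : a \in A -> (forall b, b \in A -> ~~ lt a b) ->
  #|A| = #|lower a|.+1.
Proof.
move=> aA last_a; have {1}-> : A = a |: lower a.
  apply/setP=> c; rewrite !inE; case: eqVneq => [->|ca] //=.
  case cA: (c \in A) => //=; have := total ca.
  by rewrite (negbTE (last_a c cA)) orbF => ->.
by rewrite cardsU1 !inE irr andbF.
Qed.

(* The first conjunct of [alternating] forces [S] to consist of the elements of
   even rank; the second excludes the last element, whose rank is
   [#|A|.-1]. *)
Lemma alternatingP (S : {set T}) : reflect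
  (~~ odd #|A| /\ forall a, a \in A -> (a \in S) = ~~ odd #|lower a|)
  (alternating lt A S).
Proof.
apply: (iffP forallP) => [alt|[evenA SA] a]; last first.
  apply/implyP=> aA; rewrite SA //; apply/andP; split; last first.
    apply/implyP=> /forallP last_a; apply: contra evenA.
    by rewrite (@card_lower_last a) // => b; apply/implyP.
  apply/eqP; congr negb; apply/idP/existsP=> [odda|[b /and4P[bA bS ba nb]]]; last first.
    by rewrite (card_lower_pred bA ba nb) /= -SA.
  have [|b [bA ba nb]] := @exists_pred a; first by case: #|_| odda.
  exists b; rewrite bA ba nb SA // !andbT /=.
  by move: odda; rewrite (card_lower_pred bA ba nb).
have SA a : a \in A -> (a \in S) = ~~ odd #|lower a|.
  (* Strong induction on the rank: membership of [a] is decided by its immediate predecessor. *)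
  have [n] := ubnP #|lower a|; elim: n a => // n IH a an aA.
  have /implyP/(_ aA)/andP[/eqP -> _] := alt a; congr negb.
  have IHb b : b \in A -> lt b a -> (b \in S) = ~~ odd #|lower b|.
    by move=> bA ba; apply: IH => //; have := card_lower_lt bA ba; lia.
  apply/existsP/idP=> [[b /and4P[bA bS ba nb]]|odda].
    by rewrite (card_lower_pred bA ba nb) /= -IHb.
  have [|b [bA ba nb]] := @exists_pred a; first by case: #|_| odda.
  exists b; rewrite bA ba nb IHb // !andbT /=.
  by move: odda; rewrite (card_lower_pred bA ba nb).
split=> //; have [->|[a0 a0A]] := set_0Vmem A; first by rewrite cards0.
(* An element of maximal rank is the last one. It lies outside [S], so its rank is odd and [#|A|],
   one more, is even. *)
case: (arg_maxnP (fun b => #|lower b|) a0A) => a aA amax.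
have last_a b : b \in A -> ~~ lt a b.
  by move=> bA; apply/negP=> ab; have := amax b bA; rewrite /= leqNgt card_lower_lt.
have /implyP/(_ aA)/andP[_ /implyP] := alt a.
rewrite SA // (card_lower_last aA last_a) /= negbK => -> //.
by apply/forallP=> b; apply/implyP; apply: last_a.
Qed.

End Alternating.

(** Makes comprehension first-order: by finiteness, the empty set and insertion of one atom generate
    all sets of atoms. *)
Lemma full_atomsP (M : structure void edge_symbol) :
  full_atoms M <->
  (exists X : M, forall a, a \in atoms M -> ~~ bin E a X) /\
  (forall X a, a \in atoms M -> exists Y : M, forall b, b \in atoms M ->
     bin E b Y = bin E b X || (b == a)).
Proof.
split=> [full|[[X0 X0E] ins] S].
  split=> [|X a aA].
    have [X X0] := full set0 (sub0set _); exists X => a aA.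
    by have /setP/(_ a) := X0; rewrite in_setI aA andbT !inE => ->.
  have [|Y Yset] := full (a |: trace X).
    by rewrite subUset sub1set aA subsetIr.
  exists Y => b bA; have /setP/(_ b) := Yset.
  by rewrite in_setU1 !in_setI bA !andbT !inE orbC.
have [n] := ubnP #|S|; elim: n S => // n IH S; rewrite ltnS => cardS SA.
have [->|[a aS]] := set_0Vmem S.
  exists X0; apply/setP=> b; rewrite in_setI !inE; apply/andP=> -[bX bA].
  by have := X0E b; rewrite inE bX; apply/implyP.
have [||X XS] := IH (S :\ a).
- by move: cardS; rewrite (cardsD1 a) aS.
- by apply: subset_trans SA; apply: subD1set.
have [Y YE] := ins X a (subsetP SA _ aS).
exists Y; apply/setP=> b; rewrite in_setI inE.
case bA: (b \in atoms M); last first.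
  by rewrite andbF; apply/esym/negbTE/negP=> /(subsetP SA); rewrite bA.
rewrite YE // andbT; have /setP/(_ b) := XS; rewrite in_setI bA andbT !inE => ->.
by case: eqVneq => [->|]; rewrite ?aS ?orbF.
Qed.

(** * The defining sentence and its semantics *)

(** Transcribes [full_atomsP]. Bound variables start at 1 because index 0 is reserved for the
    hub. *)
Definition atoms_full_formula : oformula :=
  Fand
    (Fex 1 (Fall 2 (Fimp (Fatom 3 2) (Fnot (Fbin (Base E) 2 1)))))
    (Fall 1 (Fall 2 (Fimp (Fatom 3 2) (Fex 3 (Fall 4 (Fimp (Fatom 5 4)
       (Fiff (Fbin (Base E) 4 3) (For (Fbin (Base E) 4 1) (Feq 4 2))))))))).

Definition alternating_formula : oformula :=
  Fex 1 (Fall 2 (Fimp (Fatom 3 2) (Fand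
    (Fiff (Fbin (Base E) 2 1) (Fnot (Fex 3 (Fand (Fatom 4 3) (Fand
       (Fbin (Base E) 3 1) (Fand (Fbin Less 3 2) (Fall 4 (Fimp (Fatom 5 4)
         (Fnot (Fand (Fbin Less 3 4) (Fbin Less 4 2)))))))))))
    (Fimp (Fall 3 (Fimp (Fatom 4 3) (Fnot (Fbin Less 2 3))))
      (Fnot (Fbin (Base E) 2 1)))))).

(** Using [below X] rather than [trace X] is harmless: [alternating] tests its last argument on
    atoms only. *)
Lemma sat_alternating_formula (M : structure void edge_symbol) (lt : rel M)
    (v : nat -> expand lt) :
  sat v alternating_formula = [exists X : M, alternating lt (atoms M) (below X)].
Proof.
rewrite /alternating_formula sat_ex; apply: eq_existsb => X.
rewrite sat_all; apply: eq_forallb => a.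
rewrite sat_imp sat_atom // sat_and sat_iff sat_imp sat_all !sat_not sat_ex.
have EX b : bin E b X = (b \in below X) by rewrite inE.
congr (_ ==> ((_ == ~~ _) && (_ ==> ~~ _))); try exact: EX.
  apply: eq_existsb => b; rewrite !sat_and sat_atom // sat_all.
  congr [&& _, _, _ & _]; first exact: EX.
  by apply: eq_forallb => c; rewrite sat_imp sat_atom.
by apply: eq_forallb => b; rewrite sat_imp sat_atom.
Qed.

Lemma sat_atoms_full_formula (M : structure void edge_symbol) (lt : rel M)
    (v : nat -> expand lt) :
  sat v atoms_full_formula <-> full_atoms M.
Proof.
rewrite full_atomsP /atoms_full_formula sat_and sat_ex sat_all.
split=> [/andP[/existsP[X hX] /forallP ins]|[[X hX] ins]].
  split=> [|Y a aA].
    exists X => a aA; move: hX; rewrite sat_all => /forallP/(_ a).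
    by rewrite sat_imp sat_atom // => /implyP/(_ aA).
  have := ins Y; rewrite sat_all => /forallP/(_ a).
  rewrite sat_imp sat_atom // => /implyP/(_ aA).
  rewrite sat_ex => /existsP[Z]; rewrite sat_all => /forallP hZ.
  exists Z => b bA; have := hZ b.
  by rewrite sat_imp sat_atom // => /implyP/(_ bA); rewrite sat_iff => /eqP.
apply/andP; split.
  apply/existsP; exists X; rewrite sat_all; apply/forallP=> a.
  by rewrite sat_imp sat_atom //; apply/implyP=> /hX.
apply/forallP=> Y; rewrite sat_all; apply/forallP=> a.
rewrite sat_imp sat_atom //; apply/implyP=> /(ins Y)[Z hZ].
rewrite sat_ex; apply/existsP; exists Z; rewrite sat_all; apply/forallP=> b.
rewrite sat_imp sat_atom //; apply/implyP=> /hZ hb.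
by rewrite sat_iff; apply/eqP.
Qed.

(** The child root is quantified without a guard, so it ranges over the whole structure; each of its
    values must equal some element with an edge to the root. *)
Definition hub_formula (Sigma : choiceType) (a : Sigma) : cformula void Sigma :=
  Fall (rcons [::] a, 0) (Fex ([::], 1)
    (Fand (Fbin (Base E) ([::], 1) ([::], 0)) (Feq (rcons [::] a, 0) ([::], 1)))).

Definition even_powerset_formula (Sigma : choiceType) (a : Sigma) : cformula void Sigma :=
  Fex ([::], 0) (Fand (hub_formula a)
    (to_cfo Sigma (Fand atoms_full_formula alternating_formula))).

Lemma cfo_hub_formula (Sigma : choiceType) (a : Sigma) k :
  cfo k.+2 (root_vars Sigma 1) (hub_formula a).
Proof.
have root_in : (([::] : seq Sigma), 0) \in root_vars Sigma 1 by rewrite in_root_vars.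
have vchild : valid ((rcons [::] a, 0) |` root_vars Sigma 1)%fset.
  split=> [w i j ji|w b].
    by rewrite !inE !xpair_eqE; case: i ji => [|i] //; rewrite !andbF.
  rewrite in_fset1U in_root_vars xpair_eqE eqxx andbT eqseq_rcons.
  by case/orP=> [/andP[/eqP -> _]|]; [rewrite in_fset1U root_in orbT|case: w].
have vcluster : valid (([::], 1) |` ((rcons [::] a, 0) |` root_vars Sigma 1))%fset.
  split=> [w i j ji|w b].
    rewrite in_fset1U xpair_eqE => /orP[/andP[/eqP -> /eqP i1]|/(vchild.1 _ _ _ ji)].
      by rewrite !inE !xpair_eqE; move: ji; rewrite i1 ltnS leqn0 => ->; rewrite !orbT.
    by move=> wj; rewrite in_fset1U; apply/orP; right.
  rewrite in_fset1U xpair_eqE andbF => /(vchild.2 _ _) ?.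
  by rewrite in_fset1U; apply/orP; right.
apply/cfo_not/cfo_quant; first exact: valid_root_vars.
apply: quant_child => //; first by rewrite in_root_vars.
apply/cfo_not/cfo_quant => //; apply: quant_cluster.
- by rewrite in_fset1U root_in orbT.
- by rewrite in_fset1U in_root_vars.
- by case=> // _; rewrite in_fset1U root_in orbT.
(* This equality crosses clusters, as allowed between a child root and its parent cluster. *)
apply: cfo_atom_cfo => //; apply: (@atom_parent _ _ _ [::] a 1); last exact: cmp_eq.
  by rewrite in_fset1U fset1U1 orbT.
exact: fset1U1.
Qed.

Lemma CFO_even_powerset_formula (Sigma : choiceType) (a : Sigma) :
  CFO (even_powerset_formula a).
Proof.
pose f := Fand atoms_full_formula alternating_formula.
(* One level is spent on the root; the remaining [(qrank f).+2] cover both the two quantifiers of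
   the hub formula and those of [f]. *)
exists (qrank f).+3; apply: cfo_quant; first exact: (valid_root_vars _ 0).
apply: quant_root => //; rewrite -[[fset _]%fset]fsetU0.
apply: cfo_and; first exact: cfo_hub_formula.
by apply: (@cfo_to_cfo Sigma f 1) => //; apply: leqW (leqW (leqnn _)).
Qed.

Lemma sat_even_powerset_formula (Sigma : choiceType) (a : Sigma)
    (M : structure void edge_symbol) (lt : rel M) (v : cvar Sigma -> expand lt) :
  linear_order lt -> even_powerset M <-> sat v (even_powerset_formula a).
Proof.
move=> lt_lin.
have sat_hub (H : M) : sat (upd v ([::], 0) H) (hub_formula a) = (below H == setT).
  have satE x y : sat (upd (upd (upd v ([::], 0) H) (rcons [::] a, 0) x) ([::], 1) y)
      (Fand (Fbin (Base E) ([::], 1) ([::], 0)) (Feq (rcons [::] a, 0) ([::], 1)))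
      = bin E y H && (x == y).
    by rewrite /= !(upd_eq, upd_neq).
  rewrite /hub_formula sat_all; apply/forallP/eqP=> [h|bH x].
    apply/setP=> x; rewrite !inE; have := h x; rewrite sat_ex.
    by case/existsP=> y; rewrite satE => /andP[+ /eqP ->].
  rewrite sat_ex; apply/existsP; exists x; rewrite satE eqxx andbT.
  by have /setP/(_ x) := bH; rewrite !inE.
have sat_body (H : M) : below H = setT ->
    sat (upd v ([::], 0) H) (to_cfo Sigma (Fand atoms_full_formula alternating_formula))
    <-> full_atoms M /\ ~~ odd #|atoms M|.
  move=> bH.
  rewrite (@sat_to_cfo _ _ _ 1 _ (fun i => upd v ([::], 0) H ([::], i))) //; last first.
    by move=> x; rewrite upd_eq; have /setP/(_ x) := bH; rewrite !inE.
  rewrite sat_and; split=> [/andP[/sat_atoms_full_formula full]|[full evenM]].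
    by rewrite sat_alternating_formula => /existsP[X /(alternatingP _ lt_lin)[]].
  apply/andP; split; first exact/sat_atoms_full_formula.
  rewrite sat_alternating_formula; apply/existsP.
  (* Fullness supplies an element coding the atoms of even rank. *)
  have [|X XS] := full [set b in atoms M | ~~ odd #|lower lt (atoms M) b|].
    by apply/subsetP=> b; rewrite inE => /andP[].
  exists X; apply/(alternatingP _ lt_lin); split=> // b bA.
  by have /setP/(_ b) := XS; rewrite in_setI [X in _ = X]inE bA andbT.
rewrite /even_powerset_formula sat_ex; split=> [[[H bH] full evenM]|/existsP[H]].
  by apply/existsP; exists H; rewrite sat_and sat_hub bH eqxx; apply/sat_body.
rewrite sat_and sat_hub => /andP[/eqP bH /(sat_body _ bH)[full evenM]].
by split=> //; exists H.
Qed.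

Theorem mainTheorem3 (Sigma : choiceType) (Sigma_infinite : infinite_alphabet Sigma) :
  exists P : structure void edge_symbol -> Prop,
    [/\ iso_closed P,
        order_invariant_CFO_definable Sigma P &
        ~ FO_definable P].
Proof.
have [a _] := Sigma_infinite [::].
have truthE (M : structure void edge_symbol) (lt : rel M) : linear_order lt ->
    even_powerset M <-> truth (expand lt) (even_powerset_formula a).
  move=> lt_lin; split=> [evenM v|tr]; first exact/sat_even_powerset_formula.
  (* A nonempty domain provides a valuation at which to use [truth]. *)
  have /card_gt0P[x0 _] := dom_gt0 M.
  exact/(sat_even_powerset_formula a (fun=> x0) lt_lin).
exists even_powerset; split; [exact: even_powerset_iso| |exact: even_powerset_not_FO].
exists (even_powerset_formula a); split=> //; first exact: CFO_even_powerset_formula.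
(* Both truth values are equivalent to [even_powerset M], which does not mention the order. *)
by move=> M lt1 lt2 lin1 lin2; rewrite -(truthE M lt1 lin1) (truthE M lt2 lin2).
Qed.
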